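(* Let $G$ be a simple graph with vertex set $\{1,\ldots,n\}$. Then $$I_{G,k}=\bigcap_{\nu}A_{\nu},$$ where $\nu$ runs over all proper $k$-colorings of $G$ (if $G$ has no proper $k$-coloring, the intersection is understood to be the whole ring $R=\langle 1\rangle$).
   Context: $G$ is a simple undirected graph with vertex set $\{1,\ldots,n\}$ and edge set $E$. $k$ is a fixed positive integer with $k<n$. $C_k$ is a fixed set of $k$ colors; a $k$-coloring of $G$ is a map $\nu:\{1,\ldots,n\}\to C_k$ (not necessarily surjective), and it is proper if adjacent vertices receive different colors. $\Bbbk$ is an algebraically closed field of characteristic not dividing $k$, and $R=\Bbbk[x_1,\ldots,x_n]$. The ideal $I_{G,k}\subseteq R$ is generated by the polynomials $x_i^k-1$ for all $i\in\{1,\ldots,n\}$ together with $x_i^{k-1}+x_i^{k-2}x_j+\cdots+x_ix_j^{k-2}+x_j^{k-1}$ for all $\{i,j\}\in E$. For $U\subseteq\{1,\ldots,n\}$ and $d\ge 0$, $h_U^d$ denotes the sum of all monomials of degree $d$ in the indeterminates $\{x_i: i\in U\}$, with $h_U^0=1$. Given a proper $k$-coloring $\nu$ of $G$, let $l\le k$ be the number of distinct colors in the image of $\nu$. The color class $cl(i)$ of a vertex $i$ is the set of vertices with the same color as $i$. Let $m_1<m_2<\cdots<m_l=n$ be the maximums (largest vertices) of the $l$ color classes. For each vertex $i$ define $$g_i=\begin{cases}x_i^k-1 & \text{if } i=m_l,\\ h^{k-l+j}_{\{m_j,\ldots,m_l\}} & \text{if } i=m_j \text{ for some } j\ne l,\\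 x_i-x_{\max cl(i)} & \text{otherwise.}\end{cases}$$ The coloring ideal associated to $\nu$ is $A_\nu=\langle g_1,\ldots,g_n\rangle\subseteq R$. *)

(* Defs.v *)
From HB Require Import structures.
From mathcomp Require Import all_boot all_order all_algebra.
From mathcomp Require Import mpoly.

Set Implicit Arguments.
Unset Strict Implicit.
Unset Printing Implicit Defensive.

Import GRing.Theory.
Local Open Scope ring_scope.

(* S is an arbitrary subset of A, so no finiteness of the generating set is
   presupposed. The empty sum gives 0. *)
Definition ideal_gen (A : comNzRingType) (S : A -> Prop) (p : A) : Prop :=
  exists s : seq (A * A),
    (forall q, q \in s -> S q.2) /\ p = \sum_(q <- s) q.1 * q.2.

Section Coloring.

Variables (n : nat) (C : finType).

(* Vertices {1, ..., n} are encoded as 'I_n = {0, ..., n - 1} with the same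
   order. *)
Definition proper_coloring (E : rel 'I_n) (nu : {ffun 'I_n -> C}) : bool :=
  [forall i, forall j, E i j ==> (nu i != nu j)].

Definition num_colors (nu : {ffun 'I_n -> C}) : nat :=
  #|[set nu i | i : 'I_n]|.

Definition color_class (nu : {ffun 'I_n -> C}) (i : 'I_n) : {set 'I_n} :=
  [set j | nu j == nu i].

Definition max_class (nu : {ffun 'I_n -> C}) (i : 'I_n) : 'I_n :=
  [arg max_(j > i in color_class nu i) (j : nat)]%N.

(* The sequence m_1 < ... < m_l; enum lists a set of ordinals in increasing
   order. *)
Definition class_maxima (nu : {ffun 'I_n -> C}) : seq 'I_n :=
  enum [set max_class nu i | i : 'I_n].

Lemma max_class_mem (nu : {ffun 'I_n -> C}) i :
  max_class nu i \in color_class nu i.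
Proof. by rewrite /max_class; case: arg_maxnP => //; rewrite inE. Qed.

Lemma max_class_ge (nu : {ffun 'I_n -> C}) i j :
  j \in color_class nu i -> (j <= max_class nu i)%N.
Proof.
move=> ij; rewrite /max_class; case: arg_maxnP => [|m _ max_m].
  by rewrite inE.
exact: max_m.
Qed.

Lemma class_maxima_sorted (nu : {ffun 'I_n -> C}) :
  sorted ltn [seq val m | m <- class_maxima nu].
Proof.
rewrite /class_maxima {1}/enum_mem -enumT sorted_map.
apply: sorted_filter => [x y z|]; first exact: ltn_trans.
by rewrite -sorted_map val_enum_ord iota_ltn_sorted.
Qed.

Lemma size_class_maxima (nu : {ffun 'I_n -> C}) :
  size (class_maxima nu) = num_colors nu.
Proof.
have nuM i : nu (max_class nu i) = nu i.
  by have := max_class_mem nu i; rewrite inE => /eqP.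
rewrite /class_maxima -cardE /num_colors.
have -> : [set nu i | i : 'I_n] = nu @: [set max_class nu i | i : 'I_n].
  by rewrite -imset_comp; apply: eq_imset => i /=; rewrite nuM.
rewrite card_in_imset // => _ _ /imsetP[i _ ->] /imsetP[j _ ->].
rewrite !nuM => nuij; apply/val_inj/eqP; rewrite eqn_leq.
by apply/andP; split; apply: max_class_ge; rewrite inE nuM nuij.
Qed.

End Coloring.

Section Ideals.

Variables (K : fieldType) (n : nat).

Definition hsym (U : {set 'I_n}) (d : nat) : {mpoly K[n]} :=
  \sum_(m : 'X_{1..n < d.+1}
        | (mdeg m == d) && [forall i, (m i != 0%N) ==> (i \in U)]) 'X_[m].

Definition graph_ideal (E : rel 'I_n) (k : nat) : {mpoly K[n]} -> Prop :=
  ideal_gen (fun p : {mpoly K[n]} =>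
    (exists i : 'I_n, p = 'X_i ^+ k - 1) \/
    (exists i j : 'I_n, E i j /\
       p = \sum_(a < k) 'X_i ^+ (k.-1 - a)%N * 'X_j ^+ a)).

Variables (C : finType) (k : nat).

(* With 1-based j, i = m_j iff j = (index i ms).+1, and then {m_j, ..., m_l} is
   drop (index i ms) ms. The truncated subtraction k - l is harmless: there are
   at most k colors. *)
Definition coloring_gen (nu : {ffun 'I_n -> C}) (i : 'I_n) : {mpoly K[n]} :=
  let ms := class_maxima nu in
  let l := num_colors nu in
  let j := (index i ms).+1 in
  if i \notin ms then 'X_i - 'X_(max_class nu i)
  else if j == l then 'X_i ^+ k - 1
  else hsym [set m in drop j.-1 ms] (k - l + j)%N.

Definition coloring_ideal (nu : {ffun 'I_n -> C}) : {mpoly K[n]} -> Prop :=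
  ideal_gen (fun p => exists i : 'I_n, p = coloring_gen nu i).

End Ideals.

(* Main.v *)
Require Import Defs.
From HB Require Import structures.
From mathcomp Require Import all_boot all_order all_algebra.
From mathcomp Require Import separable cyclotomic.
From mathcomp Require Import mpoly.

Import GRing.Theory.
Local Open Scope ring_scope.

(** Let mu_k be the set of k-th roots of unity of the field.  It has exactly k
    elements, since the characteristic does not divide k, so the points of
    mu_k^n may be identified with the k-colorings of the vertices, through a
    bijection w from colors to mu_k.

    Both kinds of ideal contain every X_i^k - 1.  Such an ideal is determined by
    its zeros, all of which lie in mu_k^n, and no general Nullstellensatz is
    needed: Lagrange interpolation writes 1 as the sum, over the points of
    mu_k^n, of polynomials e_mu such that g e_mu is congruent to g(mu) e_mu for
    every g.  Hence f belongs to the ideal J as soon as, at every point, either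
    f vanishes or some member of J does not (finite_nullstellensatz).

    It remains to find the zeros.  Those of the graph ideal are the proper
    colorings: for roots of unity a and b, the sum of all a^i b^j with
    i + j = k - 1 is (a^k - b^k) / (a - b) = 0 if a <> b, and k a^(k-1) <> 0 if
    a = b.  Those of A_nu are the colorings with exactly the color classes of
    nu.  The generators X_i - X_(max cl(i)) make the point constant on classes,
    and the other generators say that its values at the class maxima are
    pairwise distinct roots of unity.  This rests on the identity
      t^k - 1 = (t - y_1) ... (t - y_r) h^(k-r)(t, y_1, ..., y_r)
    modulo the expressions h^(k-r+i)(y_i, ..., y_r), with y_r^k - 1 for i = r
    (root_quotientE), which comes from the divided difference formula
      (x - y) h^d(x, y, s) = h^(d+1)(x, s) - h^(d+1)(y, s).
    The same identity shows that A_nu contains every X_i^k - 1.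

    So if f is in the graph ideal and nu is proper, f vanishes at the zeros of
    A_nu, which are proper colorings, and lies in A_nu.  Conversely, if f lies
    in A_nu for every proper nu, it vanishes at every proper coloring, because
    nu is itself a zero of A_nu; so f is in the graph ideal. *)

Set Implicit Arguments.
Unset Strict Implicit.
Unset Printing Implicit Defensive.

(** * Sequences *)

Lemma uniq_map_inj (T U : eqType) (g : T -> U) s :
  uniq (map g s) -> {in s &, injective g}.
Proof.
elim: s => [|z s IH] //= /andP[gz /IH inj_s] x y.
rewrite !inE => /predU1P[->|xs] /predU1P[->|ys] // gxy; last exact: inj_s.
  by rewrite gxy map_f in gz.
by rewrite -gxy map_f in gz.
Qed.

Lemma seq_split (T : eqType) (x : T) s :
  x \in s -> exists s1 s2, s = s1 ++ x :: s2.
Proof. by case/path.splitPr=> s1 s2; exists s1, s2. Qed.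

(** * Ideals *)

Record is_ideal {A : comNzRingType} (J : A -> Prop) : Prop := IsIdeal {
  ideal0 : J 0;
  idealD : forall p q, J p -> J q -> J (p + q);
  idealMl : forall a p, J p -> J (a * p) }.

Section IdealTheory.

Variables (A : comNzRingType) (J : A -> Prop).
Hypothesis idJ : is_ideal J.

Lemma idealMr p a : J p -> J (p * a).
Proof. by rewrite mulrC; apply: (idealMl idJ). Qed.

Lemma idealN p : J p -> J (- p).
Proof. by rewrite -mulN1r; apply: (idealMl idJ). Qed.

Lemma idealB p q : J p -> J q -> J (p - q).
Proof. by move=> Jp Jq; apply: (idealD idJ) => //; apply: idealN. Qed.

Lemma ideal_sum (I : Type) (r : seq I) (P : pred I) (F : I -> A) :
  (forall i, P i -> J (F i)) -> J (\sum_(i <- r | P i) F i).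
Proof.
by move=> JF; apply: big_ind => //; [apply: (ideal0 idJ) | apply: (idealD idJ)].
Qed.

Lemma ideal_subK p q : J (p - q) -> J q -> J p.
Proof. by move=> Jpq Jq; rewrite -(subrK q p); apply: (idealD idJ). Qed.

Lemma ideal_congM p q c d : J (p - c) -> J (q - d) -> J (p * q - c * d).
Proof.
move=> Jp Jq; have -> : p * q - c * d = (p - c) * q + c * (q - d).
  by rewrite mulrBl mulrBr addrA subrK.
by apply: (idealD idJ); [apply: idealMr | apply: (idealMl idJ)].
Qed.

(** Lets a congruence between multiples of e be proved by working modulo the
    colon ideal (J : e). *)
Lemma colon_ideal e : is_ideal (fun p => J (p * e)).
Proof.
split=> [|p q|a p]; first by rewrite mul0r; apply: (ideal0 idJ).
  by rewrite mulrDl; apply: (idealD idJ).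
by rewrite -mulrA; apply: (idealMl idJ).
Qed.

End IdealTheory.

Lemma zero_ideal (A : comNzRingType) : is_ideal (fun p : A => p = 0).
Proof.
by split=> // [p q -> ->|a p ->]; rewrite ?addr0 ?mulr0.
Qed.

Lemma ideal_gen_ideal (A : comNzRingType) (S : A -> Prop) :
  is_ideal (ideal_gen S).
Proof.
split=> [|p q [s [sS ->]] [t [tS ->]]|a p [s [sS ->]]].
- by exists [::]; rewrite big_nil.
- exists (s ++ t); rewrite big_cat; split=> // x.
  by rewrite mem_cat => /orP[/sS|/tS].
exists [seq (a * x.1, x.2) | x <- s]; split=> [x /mapP[y /sS Sy ->] //|].
by rewrite big_map big_distrr; apply: eq_bigr => x _; rewrite /= mulrA.
Qed.

Lemma ideal_gen_sub (A : comNzRingType) (S : A -> Prop) p :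
  S p -> ideal_gen S p.
Proof.
move=> Sp; exists [:: (1, p)]; split=> [q|]; last by rewrite big_seq1 mul1r.
by rewrite inE => /eqP->.
Qed.

Lemma ideal_gen_min (A : comNzRingType) (S J : A -> Prop) p :
  is_ideal J -> (forall q, S q -> J q) -> ideal_gen S p -> J p.
Proof.
move=> idJ SJ [s [sS ->]]; rewrite big_seq; apply: ideal_sum => // q /sS /SJ.
exact: (idealMl idJ).
Qed.

(** * Evaluation at points with coordinates in a finite set *)

Lemma meval_ideal (K : fieldType) n (v : 'I_n -> K) :
  is_ideal (fun p : {mpoly K[n]} => p.@[v] = 0).
Proof.
by split=> [|p q vp vq|a p vp]; rewrite ?meval0 // ?mevalD ?mevalM vp ?vq
  ?addr0 ?mulr0.
Qed.

(** Modulo J every variable is a constant, hence so is every polynomial. *)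
Lemma meval_congr (K : fieldType) n (J : {mpoly K[n]} -> Prop) (v : 'I_n -> K) :
  is_ideal J -> (forall i, J ('X_i - (v i)%:MP)) ->
  forall p : {mpoly K[n]}, J (p - (p.@[v])%:MP).
Proof.
move=> idJ JX; have J0 := ideal0 idJ.
have JM (p q : {mpoly K[n]}) :
    J (p - (p.@[v])%:MP) -> J (q - (q.@[v])%:MP) ->
    J (p * q - ((p * q).@[v])%:MP).
  by rewrite mevalM rmorphM /=; apply: ideal_congM.
have J1 : J (1 - ((1 : {mpoly K[n]}).@[v])%:MP) by rewrite meval1 subrr.
have JXn i m : J ('X_i ^+ m - (('X_i ^+ m).@[v])%:MP).
  elim: m => [|m IH]; first by rewrite expr0.
  by rewrite exprS; apply: JM => //; rewrite mevalXU.
elim/mpolyind => [|c m p _ _ IH]; first by rewrite meval0 subrr.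
have -> : c *: 'X_[m] + p - ((c *: 'X_[m] + p).@[v])%:MP
    = c%:MP * ('X_[m] - (('X_[m]).@[v])%:MP) + (p - (p.@[v])%:MP).
  by rewrite mevalD mevalZ !rmorphD rmorphM /= mulrBr -mul_mpolyC opprD addrACA.
apply: (idealD idJ) => //; apply: (idealMl idJ); rewrite mpolyXE_id.
apply: (big_ind (fun p => J (p - (p.@[v])%:MP))) => // i _; exact: JXn.
Qed.

Section RootsOfUnity.

Variables (K : closedFieldType) (k : nat).
Hypothesis k_neq0 : k%:R != 0 :> K.

(** X^k - 1 is separable since k is invertible, so it has as many roots as there
    are colors. *)
Lemma exists_root_labelling (C : finType) : #|C| = k ->
  exists2 w : C -> K, injective w &
    'X^k - 1 = \prod_(c : C) ('X - (w c)%:P).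
Proof.
move=> cardC.
have k_gt0 : (0 < k)%N by case: k k_neq0 => //; rewrite eqxx.
have [r] := closed_field_poly_normal ('X^k - 1 : {poly K}).
rewrite (monicP (monicXnsubC 1 k_gt0)) scale1r => Er.
have Ur : uniq r by rewrite -separable_prod_XsubC -Er separable_Xn_sub_1.
have sz_r : size r = #|C|.
  apply: succn_inj; rewrite -(size_prod_XsubC r id) -Er cardC.
  by rewrite size_XnsubC ?k_gt0.
exists (fun c => r`_(enum_rank c)) => [c d /eqP|].
  by rewrite nth_uniq // ?sz_r // => /eqP /val_inj /enum_rank_inj.
rewrite Er (big_nth 0) big_mkord sz_r (reindex_onto enum_rank enum_val) /=.
  by apply: eq_bigl => c; rewrite enum_rankK eqxx.
by move=> i _; rewrite enum_valK.
Qed.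

End RootsOfUnity.

Section Lagrange.

Variables (K : fieldType) (C : finType) (w : C -> K).
Hypothesis w_inj : injective w.

Definition lagrange (c : C) : {poly K} :=
  \prod_(d | d != c) ((w c - w d)^-1 *: ('X - (w d)%:P)).

Lemma lagrange_scaled c : exists a, 
  ('X - (w c)%:P) * lagrange c = a *: \prod_d ('X - (w d)%:P).
Proof.
exists (\prod_(d | d != c) (w c - w d)^-1).
by rewrite /lagrange scaler_prod -scalerAr; congr (_ *: _);
  rewrite [RHS](bigD1 c).
Qed.

Lemma lagrange_self c : (lagrange c).[w c] = 1.
Proof.
rewrite horner_prod big1 // => d dc; rewrite hornerZ hornerXsubC mulVf //.
by rewrite subr_eq0 (inj_eq w_inj) eq_sym.
Qed.

Lemma lagrange_other c d : d != c -> (lagrange c).[w d] = 0.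
Proof.
by move=> dc; rewrite horner_prod (bigD1 d) //= hornerZ hornerXsubC subrr mulr0
  mul0r.
Qed.

Lemma size_lagrange c : (size (lagrange c) <= #|C|)%N.
Proof.
rewrite /lagrange scaler_prod (leq_trans (size_scale_leq _ _)) //.
rewrite -big_filter size_prod_XsubC.
have -> : size [seq d <- index_enum C | d != c] = #|predC1 c|.
  by rewrite -sum1_size big_filter -sum1_card.
by rewrite cardC1 -ltnS prednK //; apply/card_gt0P; exists c.
Qed.

(** The difference of the two sides has degree less than #|C| and vanishes at
    all the interpolation nodes. *)
Lemma sum_lagrange : (0 < #|C|)%N -> \sum_c lagrange c = 1.
Proof.
move=> C_gt0; apply/eqP; rewrite -subr_eq0; apply/eqP.
apply: (@roots_geq_poly_eq0 _ _ [seq w c | c : C]).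
- apply/allP => _ /mapP[c _ ->].
  rewrite /root hornerD hornerN hornerC horner_sum.
  rewrite (bigD1 c) //= lagrange_self big1 ?addr0 ?subrr // => d dc.
  by rewrite lagrange_other // eq_sym.
- by rewrite map_inj_uniq ?enum_uniq.
rewrite size_map -cardE (leq_trans (size_polyD _ _)) // size_polyN size_poly1.
rewrite geq_max C_gt0 andbT (leq_trans (size_sum _ _ _)) //.
by apply/bigmax_leqP => c _; apply: size_lagrange.
Qed.

End Lagrange.

Section FinitePoints.

Variables (K : fieldType) (n k : nat) (C : finType) (w : C -> K).
Hypotheses (w_inj : injective w) (C_gt0 : (0 < #|C|)%N).
Hypothesis w_roots : 'X^k - 1 = \prod_(c : C) ('X - (w c)%:P).

Lemma w_expr c : w c ^+ k = 1.
Proof.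
apply/eqP; rewrite -subr_eq0; apply/eqP.
have := congr1 (horner^~ (w c)) w_roots.
rewrite horner_prod (bigD1 c) //= hornerXsubC subrr mul0r => <-.
by rewrite !hornerE.
Qed.

(** Modulo the X_i^k - 1, the primitive idempotent of the point w \o mu. *)
Definition idem (mu : {ffun 'I_n -> C}) : {mpoly K[n]} :=
  \prod_i horner_alg 'X_i (lagrange w (mu i)).

(** Expand the product over i of the partitions of unity sum_lagrange. *)
Lemma sum_idem : \sum_mu idem mu = 1.
Proof.
rewrite -(bigA_distr_bigA (fun i c => horner_alg 'X_i (lagrange w c))) big1 //.
by move=> i _; rewrite -rmorph_sum sum_lagrange ?rmorph1.
Qed.

Variable J : {mpoly K[n]} -> Prop.
Hypotheses (idJ : is_ideal J) (JX : forall i, J ('X_i ^+ k - 1)).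

(** X_i - w (mu i) kills the factor of index i of idem mu, as their product is a
    multiple of X_i^k - 1. *)
Lemma idem_congr (mu : {ffun 'I_n -> C}) (p : {mpoly K[n]}) :
  J ((p - (p.@[w \o mu])%:MP) * idem mu).
Proof.
apply: (meval_congr (colon_ideal idJ _)) => i.
rewrite /idem (bigD1 i) //= mulrA; apply: idealMr => //.
have [a Ea] := lagrange_scaled w (mu i).
have -> : 'X_i - (w (mu i))%:MP
    = horner_alg ('X_i : {mpoly K[n]}) ('X - (w (mu i))%:P).
  by rewrite rmorphB /= horner_algX horner_algC alg_mpolyC.
rewrite -rmorphM Ea -w_roots -mul_polyC rmorphM; apply: (idealMl idJ).
by rewrite rmorphB rmorphXn /= horner_algX rmorph1.
Qed.

(** It suffices to put each f * idem mu in J.  Modulo J, it is f(mu) times the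
    idempotent; and if g in J does not vanish at mu, then J contains
    g(mu) idem mu, hence idem mu.  Asking for one of the two alternatives at
    each point keeps the argument constructive for an arbitrary predicate J. *)
Lemma finite_nullstellensatz (f : {mpoly K[n]}) :
  (forall mu : {ffun 'I_n -> C}, f.@[w \o mu] = 0 \/
     exists2 g, J g & g.@[w \o mu] != 0) -> J f.
Proof.
move=> Hf; rewrite -[f]mulr1 -sum_idem mulr_sumr; apply: ideal_sum => // mu _.
case: (Hf mu) => [f0|[g Jg g0]].
  by have := idem_congr mu f; rewrite f0 mpolyC0 subr0.
apply: (idealMl idJ).
have Jge : J ((g.@[w \o mu])%:MP * idem mu).
  have := idealB idJ (idealMr idJ (idem mu) Jg) (idem_congr mu g).
  by rewrite mulrBl opprB addrC subrK.
have := idealMl idJ (g.@[w \o mu])^-1%:MP Jge.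
by rewrite mulrA -mpolyCM mulVf // mul1r.
Qed.

End FinitePoints.

(** * Complete symmetric sums and roots of unity *)

Section CompleteSymmetric.

Variable R : comNzRingType.
Implicit Types (x y t : R) (s ys : seq R) (d k : nat).

(** The complete homogeneous symmetric polynomial of degree d, evaluated at the
    entries of s.  Recursion on s serves in every ring, whereas hsym only
    speaks of the variables of a polynomial ring. *)
Fixpoint hsum s d : R :=
  if s is x :: s' then \sum_(i < d.+1) x ^+ (d - i) * hsum s' i
  else (d == 0%N)%:R.

Lemma hsum0 s : hsum s 0 = 1.
Proof. by elim: s => //= x s IH; rewrite big_ord1 IH mul1r. Qed.

Lemma hsumS x s d : hsum (x :: s) d.+1 = x * hsum (x :: s) d + hsum s d.+1.
Proof.
rewrite /= big_ord_recr /= subnn mul1r big_distrr; congr (_ + _).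
by apply: eq_bigr => i _; rewrite /= mulrA -exprS subSn // -ltnS.
Qed.

Lemma hsum1 x d : hsum [:: x] d = x ^+ d.
Proof.
by elim: d => [|d IH]; [rewrite hsum0 | rewrite hsumS IH addr0 exprS].
Qed.

Lemma hsum_divided_difference x y s d :
  (x - y) * hsum [:: x, y & s] d = hsum (x :: s) d.+1 - hsum (y :: s) d.+1.
Proof.
elim: d => [|d IH].
  by rewrite !hsumS !hsum0 !mulr1 opprD addrACA subrr addr0.
rewrite hsumS mulrDr mulrCA IH 2!(hsumS _ s d.+1).
by rewrite mulrBr mulrBl addrA subrK opprD addrACA subrr addr0.
Qed.

(** The quotient of t^k - 1 by the product of the t - y, y in ys, when ys
    consists of distinct k-th roots of unity: see root_quotientE. *)
Definition root_quotient k t ys : R :=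
  if ys is [::] then t ^+ k - 1 else hsum (t :: ys) (k - size ys).

(** The divided difference formula, in a form that also covers the first step,
    from t^k - 1 to (t^k - y^k) / (t - y). *)
Lemma root_quotient_step k t y ys : (size (y :: ys) <= k)%N ->
  (t - y) * root_quotient k t (y :: ys)
    = root_quotient k t ys - root_quotient k y ys.
Proof.
move=> le_k; rewrite [root_quotient k t (y :: ys)]/= hsum_divided_difference.
have -> : (k - size (y :: ys)).+1 = (k - size ys)%N by rewrite subnSK.
case: ys le_k => [|z ys] // _.
by rewrite !hsum1 subn0 /root_quotient opprB addrA subrK.
Qed.

(** In a field where k is nonzero, with J = 0 and at most k entries, this says
    that the entries of ys are distinct k-th roots of unity: distinct_roots_all,
    distinct_roots_uniq and uniq_distinct_roots. *)
Fixpoint distinct_roots (J : R -> Prop) k ys : Prop :=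
  if ys is y :: ys' then
    J (root_quotient k y ys') /\ distinct_roots J k ys'
  else True.

Lemma distinct_roots_cat (J : R -> Prop) k s y ys :
  distinct_roots J k (s ++ y :: ys) -> J (root_quotient k y ys).
Proof. by elim: s => [|z s IH] /= []. Qed.

(** Each step trades a factor t - y for the error term root_quotient k y ys,
    which is one of the members of J granted by distinct_roots. *)
Lemma root_quotientE (J : R -> Prop) k t ys :
    is_ideal J -> (size ys <= k)%N -> distinct_roots J k ys ->
  J ((t ^+ k - 1) - \prod_(y <- ys) (t - y) * root_quotient k t ys).
Proof.
move=> idJ; elim: ys => [|y ys IH] le_k.
  by rewrite big_nil mul1r subrr => _; apply: (ideal0 idJ).
case=> Jy /(IH (ltnW le_k)) Jys.
rewrite big_cons mulrAC root_quotient_step // mulrBl opprB addrCA.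
rewrite [root_quotient k t ys * _]mulrC.
by apply: (idealD idJ) => //; apply: idealMr.
Qed.

End CompleteSymmetric.

Lemma rmorph_hsum (R S : comNzRingType) (f : {rmorphism R -> S}) s d :
  f (hsum s d) = hsum (map f s) d.
Proof.
elim: s d => [|x s IH] d /=; first by rewrite rmorph_nat.
rewrite rmorph_sum; apply: eq_bigr => i _.
by rewrite rmorphM rmorphXn IH.
Qed.

Lemma rmorph_root_quotient (R S : comNzRingType) (f : {rmorphism R -> S})
    k t ys :
  f (root_quotient k t ys) = root_quotient k (f t) (map f ys).
Proof.
case: ys => [|y ys]; first by rewrite /= rmorphB rmorphXn rmorph1.
by rewrite [LHS]rmorph_hsum /= size_map.
Qed.

Lemma distinct_roots_map (R S : comNzRingType) (f : {rmorphism R -> S})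
    J J' k ys :
  (forall p, J p -> J' (f p)) -> distinct_roots J k ys ->
  distinct_roots J' k (map f ys).
Proof.
move=> JJ'; elim: ys => //= y ys IH [Jy /IH sep]; split=> //.
by rewrite -rmorph_root_quotient; apply: JJ'.
Qed.

Section DistinctRootsField.

Variables (K : fieldType) (k : nat).
Hypothesis k_neq0 : k%:R != 0 :> K.

Lemma distinct_roots_all (ys : seq K) : (size ys <= k)%N ->
  distinct_roots (fun x => x = 0) k ys -> all (fun y => y ^+ k == 1) ys.
Proof.
elim: ys => [|t ys IH] //= le_k [t0 sep]; rewrite IH ?(ltnW le_k) // andbT.
have := root_quotientE t (zero_ideal K) (ltnW le_k) sep.
by rewrite t0 mulr0 subr0 => /eqP; rewrite subr_eq0.
Qed.

(** If t were a zero of the quotient and also an entry of ys, it would be a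
    double root of X^k - 1, whose derivative k X^(k-1) does not vanish at t. *)
Lemma distinct_roots_uniq (ys : seq K) : (size ys <= k)%N ->
  distinct_roots (fun x => x = 0) k ys -> uniq ys.
Proof.
elim: ys => [|t ys IH] //= le_k sep.
have le_tk : (size (t :: ys) <= k)%N := le_k.
have /andP[/eqP tk1 _] := distinct_roots_all le_tk sep.
case: sep => t0 sep; rewrite IH ?(ltnW le_k) // andbT; apply/negP => t_ys.
(* the factorization of t^k - 1 is lifted to an identity of polynomials in 'X,
   which can be differentiated *)
pose f : {rmorphism K -> {poly K}} := polyC.
have sepX : distinct_roots (fun p : {poly K} => p = 0) k (map f ys).
  by apply: distinct_roots_map sep => p ->; rewrite rmorph0.
have le_fk : (size (map f ys) <= k)%N by rewrite size_map ltnW.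
have /eqP := root_quotientE 'X (zero_ideal _) le_fk sepX.
rewrite subr_eq0 => /eqP E.
have Q0 : root (root_quotient k 'X (map f ys)) t.
  apply/rootP; have := rmorph_root_quotient (horner_eval t) k 'X (map f ys).
  rewrite /= {1}/horner_eval => ->; rewrite -map_comp.
  have -> : horner_eval t 'X = t by rewrite /horner_eval hornerX.
  rewrite -[RHS]t0; congr root_quotient.
  by rewrite -[RHS]map_id; apply: eq_map => y; rewrite /= /horner_eval hornerC.
have P0 : root (\prod_(y <- map f ys) ('X - y)) t.
  by rewrite big_map root_prod_XsubC.
have := congr1 (fun p => (p^`()).[t]) E.
rewrite derivM hornerD !hornerM (rootP Q0) (rootP P0) mulr0 mul0r addr0.
rewrite derivB derivXn derivC subr0 hornerMn hornerXn => /eqP.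
rewrite -mulr_natl mulf_eq0 (negPf k_neq0) expf_eq0 => /andP[_ /eqP t_0].
move: tk1; rewrite t_0 expr0n; case: eqP => [k0 _|_ /eqP].
  by move: k_neq0; rewrite k0 eqxx.
by rewrite eq_sym oner_eq0.
Qed.

(** Among the factors of 0 = t^k - 1, the differences t - y are nonzero. *)
Lemma uniq_distinct_roots (ys : seq K) : (size ys <= k)%N ->
    uniq ys -> all (fun y => y ^+ k == 1) ys ->
  distinct_roots (fun x => x = 0) k ys.
Proof.
elim: ys => [|t ys IH] //= le_k /andP[t_ys Uys] /andP[/eqP tk1 ys1].
have sep := IH (ltnW le_k) Uys ys1; split=> //.
have /eqP := root_quotientE t (zero_ideal K) (ltnW le_k) sep.
rewrite tk1 subrr sub0r oppr_eq0 mulf_eq0 => /orP[|/eqP//].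
rewrite prodf_seq_eq0 => /hasP[y y_ys]; rewrite subr_eq0 => /eqP ty.
by rewrite ty y_ys in t_ys.
Qed.

End DistinctRootsField.

(** * The polynomials hsym as iterated sums *)

Section Hsym.

Variables (K : fieldType) (n : nat).
Implicit Types (U : {set 'I_n}) (m : 'X_{1..n}).

Lemma mcoeff_hsym U d m : (hsym K U d)@_m =
  ((mdeg m == d) && [forall i, (m i != 0%N) ==> (i \in U)])%:R.
Proof.
rewrite /hsym raddf_sum /= big_mkcond /=.
pose E (m : 'X_{1..n}) : K :=
  ((mdeg m == d) && [forall i, (m i != 0%N) ==> (i \in U)])%:R.
rewrite -[RHS]/(E m); case: (ltnP (mdeg m) d.+1) => le_d.
  rewrite -(mcoeff_mpoly E le_d) raddf_sum; apply: eq_bigr => b _ /=.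
  by rewrite mcoeffZ mcoeffX /E; case: ifP => _; rewrite ?mul1r ?mul0r.
rewrite /E gtn_eqF //= big1 // => b _; case: ifP => // /andP[/eqP db _].
by rewrite mcoeffX; case: eqP => // bm; rewrite -bm db ltnn in le_d.
Qed.

Lemma hsym0 U : hsym K U 0 = 1.
Proof.
apply/mpolyP => m; rewrite mcoeff_hsym mcoeff1 mdeg_eq0.
by case: eqP => // ->; case: forallP => // -[] i; rewrite mnm0E.
Qed.

Lemma hsym_set0 d : hsym K (set0 : {set 'I_n}) d.+1 = 0.
Proof.
apply/mpolyP => m; rewrite mcoeff_hsym mcoeff0; case: eqP => //= dm.
case: forallP => // m0; suff m_0 : m = 0%MM by rewrite m_0 mdeg0 in dm.
by apply/mnmP => i; have := m0 i; rewrite inE implybF negbK mnm0E => /eqP.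
Qed.

(** Sort the monomials by whether x divides them. *)
Lemma hsymU1 (x : 'I_n) U d : x \notin U ->
  hsym K (x |: U) d.+1 = 'X_x * hsym K (x |: U) d + hsym K U d.+1.
Proof.
move=> xU; apply/mpolyP => m; rewrite mcoeffD !mcoeff_hsym.
have [mx0|mx] := eqVneq (m x) 0%N.
  have -> : ('X_x * hsym K (x |: U) d)@_m = 0.
    rewrite /hsym big_distrr raddf_sum big1 //= => b _.
    rewrite -mpolyXD mcoeffX; case: eqP => // bm.
    by move: mx0; rewrite -bm mnmDE mnm1E eqxx.
  rewrite add0r; congr (_ && _)%:R; apply: eq_forallb => i.
  by rewrite !inE; case: (eqVneq i x) => // ->; rewrite mx0.
have le_m : (U_(x) <= m)%MM.
  by apply/mnm_lepP => i; rewrite mnm1E; case: eqP => // <-; rewrite lt0n.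
have -> : ('X_x * hsym K (x |: U) d)@_m = (hsym K (x |: U) d)@_(m - U_(x)).
  have := mcoeffMX (hsym K (x |: U) d) U_(x) (m - U_(x)).
  by rewrite addmC submK // => <-; rewrite mulrC.
have -> : [forall i, (m i != 0%N) ==> (i \in U)] = false.
  by apply/negP => /forallP/(_ x); rewrite mx (negPf xU).
rewrite andbF addr0 mcoeff_hsym -{1}(submK le_m) mdegD mdeg1 addn1 eqSS.
congr (_ && _)%:R; apply: eq_forallb => i; rewrite !inE mnmBE mnm1E.
by case: (eqVneq i x) => [->|_]; rewrite ?implybT ?subn0.
Qed.

Lemma hsym_seq (s : seq 'I_n) d : uniq s ->
  hsym K [set i in s] d = hsum [seq 'X_i | i <- s] d.
Proof.
elim: s d => [|x s IH] d.
  move=> _; rewrite set_nil; case: d => [|d]; first by rewrite hsym0.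
  by rewrite hsym_set0.
rewrite cons_uniq => /andP[xs Us].
elim: d => [|d IHd]; first by rewrite hsym0 hsum0.
by rewrite set_cons hsymU1 ?inE // -set_cons IHd IH // map_cons hsumS.
Qed.

End Hsym.

(** * Zeros of coloring ideals and graph ideals *)

Section ColoringIdeal.

Variables (K : closedFieldType) (n k : nat) (C : finType) (w : C -> K).
Hypotheses (k_neq0 : k%:R != 0 :> K) (card_C : #|C| = k).
Hypotheses (w_inj : injective w).
Hypothesis w_roots : 'X^k - 1 = \prod_(c : C) ('X - (w c)%:P).

Section OneColoring.

Variable nu : {ffun 'I_n -> C}.

Lemma color_max_class i : nu (max_class nu i) = nu i.
Proof. by have := max_class_mem nu i; rewrite inE => /eqP. Qed.

Lemma eq_max_class i j : nu i = nu j -> max_class nu i = max_class nu j.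
Proof.
move=> nuij; apply/val_inj/eqP; rewrite eqn_leq.
by apply/andP; split; apply: max_class_ge; rewrite inE color_max_class nuij.
Qed.

Lemma mem_class_maxima i : max_class nu i \in class_maxima nu.
Proof. by rewrite mem_enum imset_f. Qed.

Lemma max_class_id i : i \in class_maxima nu -> max_class nu i = i.
Proof.
by rewrite mem_enum => /imsetP[j _ ->]; apply/eq_max_class/color_max_class.
Qed.

Lemma size_class_maxima_le : (size (class_maxima nu) <= k)%N.
Proof. by rewrite size_class_maxima -card_C max_card. Qed.

(** The degree k - l + j is k minus the number of maxima after m_j, and the
    generator X^k - 1 attached to m_l is the case of no later maximum. *)
Lemma coloring_gen_max s i r : class_maxima nu = s ++ i :: r ->
  coloring_gen K k nu i = root_quotient k 'X_i [seq 'X_j | j <- r].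
Proof.
move=> Ems; have Ums : uniq (class_maxima nu) by apply: enum_uniq.
have i_ms : i \in class_maxima nu by rewrite Ems mem_cat mem_head orbT.
have i_s : i \notin s.
  move: Ums; rewrite Ems cat_uniq => /and3P[_ /hasPn + _].
  by apply; rewrite mem_head.
have Eidx : index i (class_maxima nu) = size s.
  by rewrite Ems index_cat (negPf i_s) /= eqxx addn0.
have le_k := size_class_maxima_le.
rewrite /coloring_gen i_ms /= -size_class_maxima Eidx.
have Uir : uniq (i :: r) by move: Ums; rewrite Ems cat_uniq => /and3P[].
rewrite {}Ems size_cat /= in le_k *.
case: r Uir le_k => [|j r] Uir le_k; first by rewrite addn1 eqxx.
rewrite -[X in X == _]addn1 eqn_add2l /= drop_size_cat // hsym_seq //.
rewrite -[RHS]/(hsum [seq 'X_a | a <- i :: j :: r] _) size_map.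
rewrite [(size s + _)%N]addnC addSnnS in le_k *; congr (hsum _ _); rewrite /=.
rewrite subnDA subnK // leq_subRL //.
by apply: leq_trans le_k; rewrite leq_addr.
Qed.

Lemma coloring_gen_nonmax i : i \notin class_maxima nu ->
  coloring_gen K k nu i = 'X_i - 'X_(max_class nu i).
Proof. by rewrite /coloring_gen => ->. Qed.

Lemma coloring_distinct_roots (J : {mpoly K[n]} -> Prop) s r :
    class_maxima nu = s ++ r -> (forall i, J (coloring_gen K k nu i)) ->
  distinct_roots J k [seq 'X_j | j <- r].
Proof.
move=> + Jgen; elim: r s => //= i r IH s Ems; split.
  by rewrite -(coloring_gen_max Ems).
by apply: (IH (rcons s i)); rewrite cat_rcons.
Qed.

(** At a class maximum, X_i^k - 1 is congruent to a multiple of the generator of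
    index i; the other variables are congruent to class maxima. *)
Lemma coloring_ideal_Xk i : coloring_ideal k nu ('X_i ^+ k - 1 : {mpoly K[n]}).
Proof.
pose A := @coloring_ideal K n C k nu; rewrite -/(A _).
have idA : is_ideal A by apply: ideal_gen_ideal.
have Agen j : A (coloring_gen K k nu j) by apply: ideal_gen_sub; exists j.
have Amax j : j \in class_maxima nu -> A ('X_j ^+ k - 1).
  move=> /seq_split [s [r Ems]].
  have le_k : (size [seq 'X_a : {mpoly K[n]} | a <- r] <= k)%N.
    rewrite size_map; apply: leq_trans size_class_maxima_le.
    by rewrite Ems -cat_rcons size_cat leq_addl.
  have sep := coloring_distinct_roots (s := rcons s j) (r := r) _ Agen.
  apply: (ideal_subK idA (root_quotientE 'X_j idA le_k (sep _))).
    by rewrite cat_rcons.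
  apply: (idealMl idA).
  by rewrite -(coloring_gen_max Ems).
case: (boolP (i \in class_maxima nu)) => [/Amax //|i_ms].
have := Agen i; rewrite coloring_gen_nonmax // => /(idealMr idA).
move/(_ (\sum_(a < k) 'X_i ^+ (k.-1 - a) * 'X_(max_class nu i) ^+ a)).
rewrite -subrXX => Asub.
apply: (ideal_subK idA _ (Amax _ (mem_class_maxima i))).
by rewrite opprB addrA subrK.
Qed.

(** At a zero of the generators, the values at the class maxima are distinct and
    each vertex has the value of its maximum. *)
Lemma coloring_gens_zero (mu : {ffun 'I_n -> C}) :
    (forall i, (coloring_gen K k nu i).@[w \o mu] = 0) ->
  forall i j, nu i != nu j -> mu i != mu j.
Proof.
move=> gen0.
have mu_max i : mu (max_class nu i) = mu i.
  case: (boolP (i \in class_maxima nu)) => [/max_class_id -> //|i_ms].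
  have /eqP := gen0 i; rewrite coloring_gen_nonmax // mevalB !mevalXU subr_eq0.
  by move/eqP/w_inj.
have := coloring_distinct_roots (J := fun p => p.@[w \o mu] = 0) (s := [::])
  erefl gen0.
move/(distinct_roots_map (f := meval (w \o mu)) (J' := fun x => x = 0)
  (fun _ => id)).
rewrite -map_comp => /(distinct_roots_uniq k_neq0); rewrite size_map.
move/(_ size_class_maxima_le) => Uw i j; apply: contraNneq => muij.
have w_max a : w (mu a) = (meval (w \o mu) \o (fun j => 'X_j)) (max_class nu a).
  by rewrite /= mevalXU /= mu_max.
have /eqP := congr1 w muij; rewrite !w_max.
have /inj_in_eq -> := uniq_map_inj Uw; rewrite ?mem_class_maxima //.
move/eqP=> max_ij.
by rewrite -(color_max_class i) max_ij color_max_class.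
Qed.

Lemma coloring_ideal_point (f : {mpoly K[n]}) :
  coloring_ideal k nu f -> f.@[w \o nu] = 0.
Proof.
apply: (ideal_gen_min (meval_ideal (w \o nu))).
move=> _ [i ->]; case: (boolP (i \in class_maxima nu)) => i_ms; last first.
  by rewrite coloring_gen_nonmax // mevalB !mevalXU /= color_max_class subrr.
have : uniq [seq w (nu j) | j <- class_maxima nu].
  rewrite map_inj_in_uniq ?enum_uniq // => a b a_ms b_ms /w_inj /eq_max_class.
  by rewrite !max_class_id.
have [s [r Ems]] := seq_split i_ms.
move=> Uw; have sep : distinct_roots (fun x => x = 0) k
    [seq w (nu j) | j <- class_maxima nu].
  apply: uniq_distinct_roots Uw _.
    by rewrite size_map size_class_maxima_le.
  by apply/allP => _ /mapP[j _ ->]; rewrite (w_expr w_roots).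
rewrite (coloring_gen_max Ems) rmorph_root_quotient /= mevalXU -map_comp.
rewrite Ems map_cat map_cons in sep; rewrite -[RHS](distinct_roots_cat sep).
by congr root_quotient; apply: eq_map => j; rewrite /= mevalXU.
Qed.

End OneColoring.

Lemma graph_ideal_zero (E : rel 'I_n) (v : 'I_n -> K) (f : {mpoly K[n]}) :
    (forall i, v i ^+ k = 1) -> (forall i j, E i j -> v i != v j) ->
  graph_ideal E k f -> f.@[v] = 0.
Proof.
move=> vk vE; apply: (ideal_gen_min (meval_ideal v)).
move=> _ [[i ->]|[i [j [/vE vij ->]]]].
  by rewrite mevalB rmorphXn /= mevalXU vk meval1 subrr.
have : v i ^+ k - v j ^+ k = 0 by rewrite !vk subrr.
rewrite subrXX => /eqP; rewrite mulf_eq0 subr_eq0 (negPf vij) /= => /eqP <-.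
rewrite raddf_sum; apply: eq_bigr => a _.
by rewrite /= mevalM !rmorphXn /= !mevalXU.
Qed.

End ColoringIdeal.

Unset Implicit Arguments.
Set Strict Implicit.

Theorem theorem1p7 (n k : nat) (k_gt0 : (0 < k)%N) (k_lt_n : (k < n)%N)
    (K : closedFieldType)
    (char_k : forall p : nat, p \in [pchar K] -> ~~ (p %| k)%N)
    (C : finType) (card_C : #|C| = k)
    (E : rel 'I_n) (E_sym : ssrbool.symmetric E) (E_irr : irreflexive E)
    (f : {mpoly K[n]}) :
  graph_ideal E k f <->
  (forall nu : {ffun 'I_n -> C}, proper_coloring E nu -> coloring_ideal k nu f).
Proof.
have k_neq0 : k%:R != 0 :> K.
  apply/negP => k0; have [p p_char] := natf0_pchar k_gt0 k0.
  by have := char_k p p_char; rewrite (dvdn_pcharf p_char) k0.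
have C_gt0 : (0 < #|C|)%N by rewrite card_C.
have [w w_inj w_roots] := exists_root_labelling k_neq0 card_C.
have wk c : w c ^+ k = 1 by apply: w_expr w_roots c.
split=> [fG nu /forallP nuE|fA].
  have idA : is_ideal (@coloring_ideal K n C k nu) by apply: ideal_gen_ideal.
  apply: (finite_nullstellensatz w_inj C_gt0 w_roots idA).
    by move=> i; apply: coloring_ideal_Xk.
  move=> mu; case: (boolP [forall i, (coloring_gen K k nu i).@[w \o mu] == 0]).
    move/forallP=> gen0; left.
    apply: (graph_ideal_zero (E := E) (k := k)) fG => [i|i j Eij] //=.
    rewrite (inj_eq w_inj).
    apply: (coloring_gens_zero k_neq0 card_C w_inj (nu := nu)) => [a|].
      exact/eqP.
    by have /forallP/(_ j) := nuE i; rewrite Eij.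
  rewrite negb_forall => /existsP[i gen_i]; right.
  by exists (coloring_gen K k nu i); first by apply: ideal_gen_sub; exists i.
have idG : is_ideal (@graph_ideal K n E k) by apply: ideal_gen_ideal.
apply: (finite_nullstellensatz w_inj C_gt0 w_roots idG).
  by move=> i; apply: ideal_gen_sub; left; exists i.
move=> mu; case: (boolP (proper_coloring E mu)) => [/fA fmu|].
  by left; apply: (coloring_ideal_point card_C w_inj w_roots fmu).
rewrite negb_forall => /existsP[i]; rewrite negb_forall => /existsP[j].
rewrite negb_imply negbK => /andP[Eij /eqP muij]; right.
exists (\sum_(a < k) 'X_i ^+ (k.-1 - a)%N * 'X_j ^+ a).
  by apply: ideal_gen_sub; right; exists i, j.
rewrite raddf_sum (eq_bigr (fun=> w (mu i) ^+ k.-1)) => [|a _].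
  rewrite sumr_const card_ord -mulr_natl mulf_neq0 // expf_neq0 //.
  apply/eqP => w0; have := wk (mu i); rewrite w0 expr0n gtn_eqF // => /eqP.
  by rewrite eq_sym oner_eq0.
rewrite /= mevalM !rmorphXn /= !mevalXU /= muij -exprD subnK //.
by rewrite -ltnS prednK.
Qed.
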